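(* Let $h>0$, $a\in\mathbb{R}$, $\nu\in(0,1]$, $y:(h\mathbb{N})_a\to\mathbb{R}$, and let $m\ge1$ be an integer. Then $$({}_a\Delta_{h,\ast}^{\nu}y^{2^m})(t)\le 2^m\,y^{2^m-1}(t+\nu h)\,({}_a\Delta_{h,\ast}^{\nu}y)(t),\qquad t\in(h\mathbb{N})_{a+(1-\nu)h}.$$
   Context: For $h>0$ and $a\in\mathbb{R}$, $(h\mathbb{N})_a=\{a,a+h,a+2h,\dots\}$, $\sigma(t)=t+h$, and $(\Delta_h y)(t)=\frac{y(t+h)-y(t)}{h}$. The $h$-factorial function is $t_h^{(\alpha)}=h^{\alpha}\frac{\Gamma(t/h+1)}{\Gamma(t/h+1-\alpha)}$, taken to be $0$ when $t/h+1-\alpha$ is a nonpositive integer and $t/h+1$ is not. For $\mu>0$ the fractional $h$-sum is $({}_a\Delta_h^{-\mu}y)(t)=\frac{h}{\Gamma(\mu)}\sum_{s=a/h}^{t/h-\mu}(t-\sigma(sh))_h^{(\mu-1)}y(sh)$ for $t\in(h\mathbb{N})_{a+\mu h}$, where $s$ runs over $a/h,a/h+1,\dots,t/h-\mu$ and $\sigma(sh)=(s+1)h$; and ${}_a\Delta_h^{0}y=y$. For $\nu\in(0,1]$ the Caputo-like fractional $h$-difference is $({}_a\Delta_{h,\ast}^{\nu}y)(t)=({}_a\Delta_h^{-(1-\nu)}(\Delta_h y))(t)$, $t\in(h\mathbb{N})_{a+(1-\nu)h}$ (so it equals $\Delta_h y$ if $\nu=1$). Here $y^{2^m}$ is the pointwise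 power and $y^{2^m-1}(t+\nu h)=(y(t+\nu h))^{2^m-1}$. *)

(* Defs.v *)
From mathcomp Require Import all_boot all_order all_algebra.
From mathcomp Require Import all_classical all_reals all_analysis.

Set Implicit Arguments.
Unset Strict Implicit.
Unset Printing Implicit Defensive.

Import Order.TTheory GRing.Theory Num.Theory.

Local Open Scope classical_set_scope.
Local Open Scope ring_scope.

(* Euler's integral of the second kind; meaningful for 0 < x. *)
Definition euler_gamma (R : realType) (x : R) : R :=
  Rintegral (@lebesgue_measure R) `]0, +oo[ (fun u => u `^ (x - 1) * expR (- u)).

Definition gamma_pole (R : realType) (x : R) : bool := - x \is a Num.nat.

(* For x <= 0 the integral is continued by the functional equation:
   Gamma x = Gamma (x + n) / (x (x + 1) ... (x + n - 1)), n being the least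
   natural number such that 0 < x + n.  At a pole the denominator is 0, so the
   value there is the junk value 0. *)
Definition Gamma (R : realType) (x : R) : R :=
  if 0 < x then euler_gamma x
  else let n := (Num.truncn (- x)).+1 in
       euler_gamma (x + n%:R) / \prod_(i < n) (x + i%:R).

Definition hgrid (R : realType) (h a : R) : set R :=
  [set t | exists k : nat, t = a + k%:R * h].

Definition hsigma (R : realType) (h t : R) : R := t + h.

(* Functions on a grid are represented by total functions R -> R; all the
   operators below, evaluated at the points of their grid, only use the values
   of their argument at the points of the grid (hgrid h a). *)
Definition hdiff (R : realType) (h : R) (y : R -> R) (t : R) : R :=
  (y (t + h) - y t) / h.

Definition hfactorial (R : realType) (h t alpha : R) : R :=
  if gamma_pole (t / h + 1 - alpha) && ~~ gamma_pole (t / h + 1) then 0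
  else h `^ alpha * (Gamma (t / h + 1) / Gamma (t / h + 1 - alpha)).

(* F lo + F (lo + 1) + ... + F hi, for real bounds such that hi - lo + 1 is a
   natural number (the number of terms). *)
Definition sum_step1 (R : realType) (lo hi : R) (F : R -> R) : R :=
  \sum_(0 <= j < Num.truncn (hi - lo + 1)) F (lo + j%:R).

(* The fractional h-sum of order mu >= 0 based at a; for mu > 0 it is meant
   for t in hgrid h (a + mu * h). *)
Definition hsum (R : realType) (h a mu : R) (y : R -> R) (t : R) : R :=
  if mu == 0 then y t
  else h / Gamma mu *
       sum_step1 (a / h) (t / h - mu)
         (fun s => hfactorial h (t - hsigma h (s * h)) (mu - 1) * y (s * h)).

(* Meant for 0 < nu <= 1 and t in hgrid h (a + (1 - nu) * h). *)
Definition hcaputo (R : realType) (h a nu : R) (y : R -> R) : R -> R :=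
  hsum h a (1 - nu) (hdiff h y).

(* Main.v *)
Require Import Defs.
From mathcomp Require Import all_boot all_order all_algebra.
From mathcomp Require Import all_classical all_reals all_analysis.
From mathcomp Require Import measurable_realfun.
From mathcomp Require Import ring lra zify.

(** Put M = 2^m, b = y (t + nu h), mu = 1 - nu and z_j = y (a + j h).  At the
    grid point t = a + mu h + k h the Caputo difference is, up to a nonnegative
    factor, the convolution of the increments z_(j+1) - z_j, 0 <= j <= k, with
    the weights c_(k-j), where c_n = Gamma (n + mu) / Gamma (n + 1)
    ([hcaputoE]).  The
    operator kills constants, so the difference of the two sides of the
    inequality is the same convolution applied to the sequence
      g_j = z_j^M - b^M - M b^(M-1) (z_j - b),
    the gap between the convex function z^M and its tangent at b.  Hence
    g >= 0 ([pow2_tangent_le]), and g_(k+1) = 0 because z_(k+1) = b.  As the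
    weights c_(k-j) are nonnegative and grow with j, summation by parts gives
      sum_j c_(k-j) (g_(j+1) - g_j) <= c_0 g_(k+1) = 0  ([sum_increments_le]).
    For nu = 1 the operator is the plain difference quotient and the tangent
    inequality alone suffices.

    The remaining point is that c_n decreases.  This is the monotonicity of
    p |-> Gamma (p + 1) / Gamma p ([euler_gamma_ratio_le]) between p = n + mu
    and p = n + 1.  It is Chebyshev's integral inequality for the weight
    u^(q-1) exp (- u), and it rests on the finiteness and the positivity of
    Euler's integral at every positive argument. *)

Set Implicit Arguments.
Unset Strict Implicit.
Unset Printing Implicit Defensive.

Import Order.TTheory GRing.Theory Num.Theory.
Import numFieldNormedType.Exports.

Local Open Scope ring_scope.
Local Open Scope classical_set_scope.

(** * Convergence and positivity of Euler's integral *)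

Definition gamma_integrand (R : realType) (p u : R) : R :=
  u `^ (p - 1) * expR (- u).

Lemma measurable_gamma_integrand (R : realType) (p : R) (D : set R) :
  measurable D -> measurable_fun D (gamma_integrand p).
Proof.
move=> mD; apply: (@measurable_funS _ _ _ _ setT) => //.
apply: measurable_funM => //.
by apply: measurableT_comp => //; exact: measurable_expR.
Qed.

Lemma itv0c1_bigcup (R : realType) :
  `]0, 1] = \bigcup_n [set` `[n.+2%:R^-1, (1 : R)]%R].
Proof.
apply/seteqP; split => [u|u [n _]] /=; rewrite !in_itv /=.
  move=> /andP[u0 u1]; exists (Num.truncn u^-1) => //=.
  rewrite in_itv /= u1 andbT -[leRHS]invrK lef_pV2 ?posrE ?invr_gt0//.
  apply/ltW/(lt_trans (truncnS_gt _)).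
  by rewrite ltr_nat.
by move=> /andP[nu ->]; rewrite andbT (lt_le_trans _ nu)// invr_gt0.
Qed.

(** The primitive u^p / p is bounded by 1 / p on [0, 1], whereas the integrand
    may be unbounded at 0; the fundamental theorem is therefore applied on
    [1/(n+2), 1], and monotone convergence gives the limit. *)
Lemma integral_powR_itv01_lty (R : realType) (p : R) : 0 < p ->
  (\int[@lebesgue_measure R]_(u in `]0%R, 1%R]) (u `^ (p - 1))%:E < +oo)%E.
Proof.
move=> p0; rewrite itv0c1_bigcup.
have cF : (\int[@lebesgue_measure R]_(u in [set` `[n.+2%:R^-1%R, (1 : R)%R]%R]) (u `^ (p - 1))%:E
    @[n --> \oo] --> \int[@lebesgue_measure R]_(u in \bigcup_n [set` `[n.+2%:R^-1%R, (1 : R)%R]%R])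
      (u `^ (p - 1))%:E)%E.
  apply: ge0_nondecreasing_set_cvg_integral => //.
  - move=> m n mn; rewrite subsetEset; apply: subset_itvr.
    by rewrite bnd_simp lef_pV2 ?posrE// ler_nat.
  - move=> i; apply/measurable_EFinP.
    exact: (@measurable_funS _ _ _ _ setT).
  - by move=> i x _; rewrite lee_fin powR_ge0.
apply: (@le_lt_trans _ _ (p^-1)%:E); last exact: ltry.
rewrite -(cvg_lim _ cF)//; apply: lime_le; first by apply/cvg_ex; eexists; exact: cF.
apply: nearW => n.
have n2 : 0 < (n.+2%:R^-1 : R) by rewrite invr_gt0.
have P (x : R) : 0 < x ->
    is_derive x 1 (fun u : R => p^-1 * u `^ p) (x `^ (p - 1)).
  move=> x0.
  have := @is_deriveZ _ _ _ _ p^-1 _ _ _ (is_derive1_powR p x0).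
  by rewrite /GRing.scale /= mulrA mulVf ?gt_eqF// mul1r.
have C (q x : R) : 0 < x -> {for x, continuous (fun u : R => u `^ q)}.
  move=> x0; apply/differentiable_continuous/derivable1_diffP.
  by have [] := is_derive1_powR q x0.
rewrite (@continuous_FTC2 _ _ (fun u => p^-1 * u `^ p)) //.
- by rewrite powR1 mulr1 -EFinB lee_fin gerBl mulr_ge0 ?powR_ge0// invr_ge0 ltW.
- by rewrite invf_lt1// ltr1n.
- apply: continuous_in_subspaceT => x; rewrite inE /= in_itv /= => /andP[nx _].
  exact/C/(lt_le_trans n2).
- split.
  + move=> x; rewrite in_itv /= => /andP[nx _].
    by have [] := P x (lt_trans n2 nx).
  + apply: cvg_at_right_filter; apply: cvgMr; exact: C.
  + apply: cvg_at_left_filter; apply: cvgMr; exact: C.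
- move=> x; rewrite in_itv /= => /andP[nx _].
  by rewrite derive1E; have [_ ->] := P x (lt_trans n2 nx).
Qed.

(** This is s <= exp s at s = u / (2 p), raised to the power p. *)
Lemma powR_le_expR_half (R : realType) (p u : R) : 0 < p -> 0 <= u ->
  u `^ p <= (2 * p) `^ p * expR (u / 2).
Proof.
move=> p0 u0.
have p20 : 0 < 2 * p by rewrite mulr_gt0.
have -> : u / 2 = u / (2 * p) * p by field; rewrite gt_eqF.
rewrite expRM -powRM ?expR_ge0 ?(ltW p20)//.
apply: ge0_ler_powR; rewrite ?nnegrE ?mulr_ge0 ?expR_ge0 ?(ltW p20) ?(ltW p0)//.
rewrite -ler_pdivrMl// mulrC; apply: le_trans (expR_ge1Dx _).
by rewrite lerDr.
Qed.

Lemma gamma_integrand_ge0 (R : realType) (p u : R) : 0 <= gamma_integrand p u.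
Proof. by rewrite mulr_ge0 ?powR_ge0 ?expR_ge0. Qed.

(** Near 0 the integrand is dominated by u^(p-1); beyond 1 it is dominated by a
    multiple of exp (- u / 2), hence of the density of the exponential law
    of rate 1/2, whose integral is 1. *)
Lemma integral_gamma_integrand_lty (R : realType) (p : R) : 0 < p ->
  (\int[@lebesgue_measure R]_(u in `]0%R, +oo[) (gamma_integrand p u)%:E < +oo)%E.
Proof.
move=> p0.
have -> : `]0, +oo[ = `]0, 1] `|` `]1, +oo[ :> set R.
  apply/seteqP; split => [u|u] /=; rewrite !in_itv /= ?andbT.
    by move=> u0; case: (leP u 1) => u1; [left; rewrite u0|right].
  by case=> [/andP[]//|]; apply: lt_trans.
rewrite ge0_integral_setU//; last 3 first.
- by apply/measurable_EFinP; apply: measurable_gamma_integrand; exact: measurableU.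
- by move=> x _; rewrite lee_fin gamma_integrand_ge0.
- rewrite disj_set2E; apply/eqP/seteqP; split => // u [] /=.
  by rewrite !in_itv /= andbT => /andP[_ u1]; rewrite ltNge u1.
apply: lte_add_pinfty.
  apply: le_lt_trans (integral_powR_itv01_lty p0).
  apply: ge0_le_integral => //.
  - by move=> x _; rewrite lee_fin gamma_integrand_ge0.
  - by apply/measurable_EFinP; exact: measurable_gamma_integrand.
  - apply/measurable_EFinP; apply: (@measurable_funS _ _ _ _ setT) => //; exact: measurable_powR.
  - move=> x; rewrite /= in_itv /= => /andP[x0 _].
    by rewrite lee_fin ler_piMr ?powR_ge0// expR_le1 oppr_le0 ltW.
(* The second factor 2 cancels the normalisation 1/2 of the density. *)
pose K := (2 * p) `^ p * 2.
have h0 : 0 < 2^-1 :> R by rewrite invr_gt0.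
have K0 : 0 <= K by rewrite mulr_ge0// powR_ge0.
have mE D : measurable D -> measurable_fun D (fun u => (K * exponential_pdf (2^-1) u)%:E).
  move=> mD; apply/measurable_EFinP; apply: measurable_funM => //.
  apply: (@measurable_funS _ _ _ _ setT) => //.
  exact: measurable_exponential_pdf.
have E0 x : (0 <= (K * exponential_pdf (2^-1) x)%:E)%E.
  by rewrite lee_fin mulr_ge0// exponential_pdf_ge0// ltW.
apply: (@le_lt_trans _ _
  (\int[@lebesgue_measure R]_(u in `]1%R, +oo[) (K * exponential_pdf (2^-1) u)%:E)%E).
  apply: ge0_le_integral => //.
  - by move=> x _; rewrite lee_fin gamma_integrand_ge0.
  - by apply/measurable_EFinP; exact: measurable_gamma_integrand.
  - exact: mE.
  - move=> x; rewrite /= in_itv /= andbT => x1.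
    have x0 : 0 < x by exact: lt_trans x1.
    rewrite lee_fin exponential_pdfE ?(ltW x0)// /K.
    apply: (@le_trans _ _ (((2 * p) `^ p * expR (x / 2)) * expR (- x))).
      rewrite ler_pM2r ?expR_gt0//; apply: le_trans (powR_le_expR_half p0 (ltW x0)).
      by rewrite ler_powR ?(ltW x1)// gerBl.
    rewrite -mulrA -expRD.
    have -> : x / 2 + - x = - 2^-1 * x by field.
    by rewrite le_eqVlt; apply/orP; left; apply/eqP; field.
apply: (@le_lt_trans _ _
  (\int[@lebesgue_measure R]_u (K * exponential_pdf (2^-1) u)%:E)%E).
  by apply: ge0_subset_integral => //; exact: mE.
under eq_integral do rewrite EFinM.
rewrite ge0_integralZl//.
- by rewrite integral_exponential_pdf// mule1 ltry.
- by apply/measurable_EFinP; exact: measurable_exponential_pdf.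
- by move=> x _; rewrite lee_fin exponential_pdf_ge0// ltW.
Qed.

Lemma integrable_gamma_integrand (R : realType) (p : R) : 0 < p ->
  (@lebesgue_measure R).-integrable `]0, +oo[ (EFin \o gamma_integrand p).
Proof.
move=> p0; apply/integrableP; split.
  by apply/measurable_EFinP; exact: measurable_gamma_integrand.
apply: le_lt_trans (integral_gamma_integrand_lty p0).
apply: ge0_le_integral => //.
- apply: measurableT_comp => //.
  by apply/measurable_EFinP; exact: measurable_gamma_integrand.
- by apply/measurable_EFinP; exact: measurable_gamma_integrand.
- by move=> x _ /=; rewrite lee_fin ger0_norm// gamma_integrand_ge0.
Qed.

(** On [1, 2] the integrand is at least u^-1 exp (- u) >= exp (- 2) / 2. *)
Lemma euler_gamma_gt0 (R : realType) (p : R) : 0 < p -> 0 < euler_gamma p.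
Proof.
move=> p0; pose c : R := 2^-1 * expR (- 2).
have c0 : 0 < c by rewrite mulr_gt0 ?expR_gt0// invr_gt0.
apply: fine_gt0; rewrite integral_gamma_integrand_lty// andbT.
apply: (@lt_le_trans _ _ c%:E); first by rewrite lte_fin.
apply: (@le_trans _ _
  (\int[@lebesgue_measure R]_(u in `[1%R, 2%R]) (gamma_integrand p u)%:E)%E); last first.
  apply: ge0_subset_integral => //.
  - by apply/measurable_EFinP; exact: measurable_gamma_integrand.
  - by move=> x _; rewrite lee_fin gamma_integrand_ge0.
  - move=> x /=; rewrite !in_itv /= andbT => /andP[x1 _].
    exact: lt_le_trans x1.
apply: (@le_trans _ _ (\int[@lebesgue_measure R]_(u in `[1%R, 2%R]) c%:E)%E).
  rewrite integral_cst//= lebesgue_measure_itv/= lte_fin ltr1n -EFinB -EFinM.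
  by rewrite lee_fin (_ : 2 - 1 = 1) ?mulr1//; ring.
apply: ge0_le_integral => //.
- by move=> x _; rewrite lee_fin ltW.
- by apply/measurable_EFinP; exact: measurable_gamma_integrand.
- move=> x /=; rewrite !in_itv /= => /andP[x1 x2].
  rewrite lee_fin ler_pM ?expR_ge0 ?invr_ge0//; last by rewrite ler_expR lerN2.
  have x0 : 0 < x by exact: lt_le_trans x1.
  apply: (@le_trans _ _ (x `^ (-1))).
    by rewrite powR_inv1 ?(ltW x0)// lef_pV2 ?posrE.
  by rewrite ler_powR// lerBrDr addNr ltW.
Qed.

(** * Monotonicity of the weights *)

Lemma gamma_integrandS (R : realType) (p u : R) : 0 < u ->
  gamma_integrand (p + 1) u = u * gamma_integrand p u.
Proof.
move=> u0; rewrite /gamma_integrand mulrA addrK; congr (_ * _).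
rewrite powRB ?powRr1 ?(ltW u0)// ?(gt_eqF u0) ?implybT// mulrC divfK//.
by rewrite gt_eqF.
Qed.

(** Chebyshev's integral inequality.  Let m = Gamma (q + 1) / Gamma q be the
    mean of u for the weight u^(q-1) exp (- u).  As u^(p-q) decreases,
      (u - m) u^(p-q) <= (u - m) m^(p-q)  for all u > 0.
    Integrated against the weight, the left side gives
    Gamma (p + 1) - m Gamma p and the right side gives 0. *)
Lemma euler_gamma_ratio_le (R : realType) (p q : R) : 0 < p -> p <= q ->
  euler_gamma (p + 1) * euler_gamma q <= euler_gamma p * euler_gamma (q + 1).
Proof.
move=> p0 pq; have q0 := lt_le_trans p0 pq.
have p10 : 0 < p + 1 by rewrite addr_gt0.
have q10 : 0 < q + 1 by rewrite addr_gt0.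
have Gq := euler_gamma_gt0 q0.
have Gq1 := euler_gamma_gt0 q10.
pose m := euler_gamma (q + 1) / euler_gamma q.
have m0 : 0 < m by rewrite divr_gt0.
rewrite -ler_pdivlMr// -mulrA -/m mulrC -subr_le0.
pose lam := m `^ (p - q).
have mR : measurable (`]0, +oo[ : set (measurableTypeR R)) by [].
have iZ r k : 0 < r -> (@lebesgue_measure R).-integrable `]0, +oo[
    (EFin \o (fun u => k * gamma_integrand r u)).
  move=> r0; have := integrableZl mR k (integrable_gamma_integrand r0).
  by apply: eq_integrable.
have iB r k : 0 < r -> (@lebesgue_measure R).-integrable `]0, +oo[
    (EFin \o (fun u => gamma_integrand (r + 1) u - k * gamma_integrand r u)).
  move=> r0; have r10 : 0 < r + 1 by rewrite addr_gt0.
  have := integrableB mR (integrable_gamma_integrand r10) (iZ r k r0).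
  by apply: eq_integrable.
have intB r k : 0 < r ->
    \int[@lebesgue_measure R]_(u in `]0, +oo[)
      (gamma_integrand (r + 1) u - k * gamma_integrand r u) =
    euler_gamma (r + 1) - k * euler_gamma r.
  move=> r0; have r10 : 0 < r + 1 by rewrite addr_gt0.
  rewrite RintegralB//; [|exact: integrable_gamma_integrand|exact: iZ].
  by rewrite RintegralZl//; exact: integrable_gamma_integrand.
rewrite -intB//.
have I0 : 0 = \int[@lebesgue_measure R]_(u in `]0, +oo[)
    (lam * (gamma_integrand (q + 1) u - m * gamma_integrand q u)).
  by rewrite RintegralZl ?intB//; [rewrite divfK ?gt_eqF// subrr mulr0|exact: iB].
rewrite [leRHS]I0; apply: le_Rintegral => //.
- exact: iB.
- have := integrableZl mR lam (iB q m q0).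
  by apply: eq_integrable.
move=> u /=; rewrite in_itv /= andbT => u0.
rewrite !gamma_integrandS// -!mulrBl.
have -> : gamma_integrand p u = u `^ (p - q) * gamma_integrand q u.
  rewrite /gamma_integrand mulrA -powRD ?(gt_eqF u0) ?implybT//.
  by rewrite addrA subrK.
rewrite [leLHS]mulrA [leRHS]mulrA; apply: ler_wpM2r; first exact: gamma_integrand_ge0.
have N x y : 0 < x -> x <= y -> y `^ (p - q) <= x `^ (p - q).
  move=> x0 xy; rewrite -opprB !powRN lef_pV2 ?posrE ?powR_gt0//; last first.
    exact: lt_le_trans xy.
  by apply: ge0_ler_powR; rewrite ?nnegrE ?subr_ge0// ltW// (lt_le_trans x0).
rewrite [leRHS]mulrC; case: (leP m u) => mu.
  by apply: ler_wpM2l; [rewrite subr_ge0|exact: N].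
by apply: ler_wnM2l; [rewrite subr_le0 ltW|apply: N => //; exact: ltW].
Qed.

Lemma Gamma_gt0E (R : realType) (x : R) : 0 < x -> Gamma x = euler_gamma x.
Proof. by rewrite /Gamma => ->. Qed.

Lemma gt0_not_gamma_pole (R : realType) (x : R) : 0 < x -> gamma_pole x = false.
Proof.
move=> x0; apply/negP => /natr_ge0.
by rewrite oppr_ge0 leNgt x0.
Qed.

(** Up to the factor h^(mu-1), the value of the h-factorial function in the
    kernel of the h-sum of order mu, n steps before the last point. *)
Definition kernel_weight (R : realType) (mu : R) (n : nat) : R :=
  euler_gamma (n%:R + mu) / euler_gamma (n%:R + 1).

Lemma kernel_weight_ge0 (R : realType) (mu : R) n : 0 < mu ->
  0 <= kernel_weight mu n.
Proof.
by move=> mu0; rewrite divr_ge0// ltW// euler_gamma_gt0// ltr_wpDl.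
Qed.

Lemma kernel_weight_le (R : realType) (mu : R) (i j : nat) :
  0 < mu -> mu <= 1 -> (i <= j)%N -> kernel_weight mu j <= kernel_weight mu i.
Proof.
move=> mu0 mu1; elim: j => [|j IH]; first by rewrite leqn0 => /eqP ->.
rewrite leq_eqVlt => /predU1P[-> //|]; rewrite ltnS => /IH; apply: le_trans.
have jmu : 0 < j%:R + mu by rewrite ltr_wpDl.
have j1 : 0 < j%:R + 1 :> R by rewrite ltr_wpDl.
have j2 : 0 < j%:R + 1 + 1 :> R by rewrite addr_gt0.
rewrite /kernel_weight -natr1 ler_pdivrMr ?euler_gamma_gt0// mulrAC.
rewrite ler_pdivlMr ?euler_gamma_gt0// addrAC.
by apply: euler_gamma_ratio_le => //; rewrite lerD2l.
Qed.

(** * The inequality *)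

(** Summation by parts, done by induction: raising the last weight from w n to
    w (n + 1) can only increase w n * g (n + 1), which is what the next
    increment needs to telescope. *)
Lemma sum_increments_le (R : realDomainType) (w g : nat -> R) (n : nat) :
  {homo w : i j / (i <= j)%N >-> i <= j} -> (forall i, 0 <= w i) ->
  (forall i, 0 <= g i) ->
  \sum_(0 <= j < n.+1) w j * (g j.+1 - g j) <= w n * g n.+1.
Proof.
move=> wmono w0 g0; elim: n => [|n IH].
  by rewrite big_nat1 mulrBr gerBl mulr_ge0.
rewrite big_nat_recr//=; apply: le_trans (lerD IH (lexx _)) _.
by rewrite mulrBr addrCA gerDl -mulrBl mulr_le0_ge0// subr_le0 wmono.
Qed.

(** The graph of x^(2^m) lies above its tangents.  The induction writes
    x^(2^(m+1)) as a square: the tangent inequality of the square at b^(2^m) is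
    followed by the inductive one, which is multiplied by 2 b^(2^m) >= 0. *)
Lemma pow2_tangent_le (R : realDomainType) (m : nat) (x b : R) : (0 < m)%N ->
  b ^+ (2 ^ m) - x ^+ (2 ^ m) <= 2 ^+ m * b ^+ (2 ^ m - 1) * (b - x).
Proof.
have E2 n : (2 ^ n.+1 = 2 ^ n * 2)%N by rewrite expnSr.
have sq (z : R) n : z ^+ (2 ^ n.+1) = (z ^+ (2 ^ n)) ^+ 2 by rewrite E2 exprM.
have sqr_tangent (u v : R) : v ^+ 2 - u ^+ 2 <= 2 * v * (v - u).
  by have := sqr_ge0 (v - u); nra.
elim: m => [//|[_ _|m IH _]]; first by rewrite expn1 subn1 /= !expr1.
set M := (2 ^ m.+1)%N in IH *.
have M0 : (0 < M)%N by rewrite expn_gt0.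
rewrite (sq b) (sq x) -/M.
have -> : b ^+ (2 ^ m.+2 - 1) = b ^+ M * b ^+ (M - 1).
  by rewrite -exprD E2 -/M; congr (_ ^+ _); lia.
have bM : 0 <= b ^+ M by rewrite /M sq sqr_ge0.
have {}IH := IH isT.
apply: (@le_trans _ _ (2 * b ^+ M * (b ^+ M - x ^+ M))); first exact: sqr_tangent.
rewrite [2 ^+ m.+2]exprS.
set K := b ^+ M in bM IH *.
have -> : 2 * 2 ^+ m.+1 * (K * b ^+ (M - 1)) * (b - x) =
  2 * K * (2 ^+ m.+1 * b ^+ (M - 1) * (b - x)) by ring.
by apply: ler_wpM2l => //; rewrite mulr_ge0.
Qed.

(** The explicit form of the operator on its grid: the arguments of both Gamma
    functions in the kernel are positive, so the kernel is a quotient of values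
    of Euler's integral, and the factor h of the sum cancels the denominator of
    the difference quotient. *)
Lemma hcaputoE (R : realType) (h a nu : R) (y : R -> R) (k : nat) :
  0 < h -> nu < 1 ->
  hcaputo h a nu y (a + (1 - nu) * h + k%:R * h) =
  h `^ (- nu) / euler_gamma (1 - nu) *
  \sum_(0 <= j < k.+1) kernel_weight (1 - nu) (k - j) *
     (y (a + j.+1%:R * h) - y (a + j%:R * h)).
Proof.
move=> h0 nu1; rewrite /hcaputo /hsum.
have mu0 : 0 < 1 - nu by rewrite subr_gt0.
rewrite gt_eqF// Gamma_gt0E// /sum_step1.
have hn0 : h != 0 by rewrite gt_eqF.
have -> : (a + (1 - nu) * h + k%:R * h) / h - (1 - nu) - a / h + 1 = k.+1%:R.
  by rewrite -natr1; field.
rewrite natrK mulrAC [in RHS]mulrAC; congr (_ / _).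
rewrite !mulr_sumr; apply: eq_big_nat => j /andP[_ jk]; rewrite /hfactorial /hdiff.
have -> : (a + (1 - nu) * h + k%:R * h - hsigma h ((a / h + j%:R) * h)) / h + 1
    = (k - j)%:R + (1 - nu) by rewrite /hsigma natrB//; field.
have -> : 1 - nu - 1 = - nu by ring.
have n1 : (k - j)%:R + (1 - nu) - - nu = (k - j)%:R + 1 by ring.
have n0 : 0 < (k - j)%:R + (1 - nu) by rewrite ltr_wpDl.
have n10 : 0 < (k - j)%:R + 1 :> R by rewrite ltr_wpDl.
rewrite n1 !gt0_not_gamma_pole// !Gamma_gt0E// /kernel_weight.
have -> : (a / h + j%:R) * h = a + j%:R * h by field.
have -> : a + j%:R * h + h = a + j.+1%:R * h by rewrite -natr1; ring.
by rewrite /=; field; rewrite hn0 gt_eqF// euler_gamma_gt0.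
Qed.

Unset Implicit Arguments.

Theorem proposition4p2 (R : realType) (h a nu : R) (y : R -> R) (m : nat)
    (h_gt0 : 0 < h) (nu_gt0 : 0 < nu) (nu_le1 : nu <= 1) (m_ge1 : (1 <= m)%N)
    (t : R) (t_grid : hgrid h (a + (1 - nu) * h) t) :
  hcaputo h a nu (fun x => y x ^+ (2 ^ m)) t
    <= 2 ^+ m * y (t + nu * h) ^+ (2 ^ m - 1) * hcaputo h a nu y t.
Proof.
case: t_grid => k ->{t}.
move: nu_le1; rewrite le_eqVlt => /predU1P[->|nu1].
  rewrite subrr mul0r addr0 mul1r /hcaputo /hsum subrr eqxx /hdiff mulrA.
  by rewrite ler_pM2r ?invr_gt0// pow2_tangent_le.
have mu0 : 0 < 1 - nu by rewrite subr_gt0.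
have mu1 : 1 - nu <= 1 by rewrite gerBl ltW.
rewrite !hcaputoE//.
have -> : a + (1 - nu) * h + k%:R * h + nu * h = a + k.+1%:R * h.
  by rewrite -natr1; ring.
rewrite mulrCA; apply: ler_wpM2l.
  by rewrite divr_ge0 ?powR_ge0// ltW// euler_gamma_gt0.
pose z j := y (a + j%:R * h); rewrite -/(z k.+1); set b := z k.+1.
pose w j := kernel_weight (1 - nu) (k - j).
pose g j :=
  z j ^+ (2 ^ m) - b ^+ (2 ^ m) - 2 ^+ m * b ^+ (2 ^ m - 1) * (z j - b).
have g0 j : 0 <= g j.
  by have := pow2_tangent_le (z j) b m_ge1; rewrite /g; lra.
have wmono : {homo w : i j / (i <= j)%N >-> i <= j}.
  by move=> i j ij; apply: kernel_weight_le => //; exact: leq_sub2l.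
have w0 j : 0 <= w j by exact: kernel_weight_ge0.
have := sum_increments_le k wmono w0 g0.
have -> : g k.+1 = 0 by rewrite /g -/b !subrr mulr0 subr0.
rewrite mulr0 => S0; rewrite -subr_le0; apply: le_trans S0.
rewrite le_eqVlt; apply/orP; left; apply/eqP.
rewrite mulr_sumr -sumrB; apply: eq_bigr => j _.
by rewrite /g /w -/(z j) -/(z j.+1); ring.
Qed.
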